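(* Let $H$ be a complex Hilbert space, let $\mathcal{C}$ be a nonempty convex subset of $\widetilde{\mathbb{R}}^H$ and let $\Phi:\mathcal{C}\rightarrow\widetilde{\mathbb{R}}^H$ be a pointwise convex map. Then for any $a,\lambda\in(0,1)$ and $f,g\in\mathcal{C}$, $$m(a,\lambda)\Big(\Phi(f)\nabla_a\Phi(g)-\Phi\big(f\nabla_a g\big)\Big)\leq\Phi(f)\nabla_\lambda\Phi(g)-\int_0^1\Phi\big(f\nabla_t g\big)\,d\nu_\lambda(t)\leq M(a,\lambda)\Big(\Phi(f)\nabla_a\Phi(g)-\Phi\big(f\nabla_a g\big)\Big),$$ where $$m(a,\lambda):=(1-\lambda)^2\,\frac{1-a^{\frac{\lambda}{1-\lambda}}}{1-a}+\lambda^2\,\frac{1-(1-a)^{\frac{1-\lambda}{\lambda}}}{a},\qquad M(a,\lambda):=\frac{1-\lambda}{1-a}+\frac{\lambda}{a}-m(a,\lambda).$$ If $\Phi$ is pointwise concave, then these inequalities are reversed.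
   Context: $\widetilde{\mathbb{R}}:=\mathbb{R}\cup\{+\infty\}$, and $\widetilde{\mathbb{R}}^H$ is the set of all functionals from $H$ to $\widetilde{\mathbb{R}}$. Inequalities between functionals are pointwise: $f\le g$ iff $f(x)\le g(x)$ for all $x\in H$. Algebraic operations and integrals of functionals are also pointwise in $x\in H$, with the convention $(+\infty)-(+\infty)=+\infty$. For $t\in(0,1)$, $f\nabla_t g:=(1-t)f+tg$, with $f\nabla_0 g:=f$ and $f\nabla_1 g:=g$. A map $\Phi:\mathcal{C}\to\widetilde{\mathbb{R}}^H$ is pointwise convex (resp. concave) if $\Phi(f\nabla_s g)\le\Phi(f)\nabla_s\Phi(g)$ (resp. $\ge$) for all $f,g\in\mathcal{C}$ and $s\in[0,1]$. For $\lambda\in(0,1)$, $\nu_\lambda$ is the probability measure on $[0,1]$ given by $$d\nu_\lambda(t)=\Big((1-\lambda)(1-t)^{\frac{1-2\lambda}{\lambda}}+\lambda t^{\frac{2\lambda-1}{1-\lambda}}\Big)dt.$$ *)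

(* Defs.v *)
From HB Require Import structures.
From mathcomp Require Import all_boot all_order all_algebra.
From mathcomp Require Import all_classical all_reals all_analysis.
From mathcomp Require Import measurable_realfun.
From mathcomp Require Import ring lra.

Set Implicit Arguments.
Unset Strict Implicit.
Unset Printing Implicit Defensive.

Import Order.TTheory GRing.Theory Num.Theory.
Import numFieldNormedType.Exports.

Local Open Scope classical_set_scope.
Local Open Scope ring_scope.

Section functionals.
Context {R : realType} {H : Type}.
Implicit Types (f g : H -> \bar R) (C : set (H -> \bar R)).
Implicit Types (Phi : (H -> \bar R) -> (H -> \bar R)).
Local Open Scope ereal_scope.

(* The functionals with values in R u {+oo}. *)
Definition functionals : set (H -> \bar R) := [set f | forall x, f x != -oo].

(* Since 0 * +oo = 0 in \bar R, the endpoint conventions f nabla_0 g = f and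
   f nabla_1 g = g hold: see nabla0 and nabla1. *)
Definition nabla (t : R) f g : H -> \bar R :=
  fun x => (1 - t)%:E * f x + t%:E * g x.

Lemma nabla0 f g : nabla 0%R f g = f.
Proof. by apply/funext => x; rewrite /nabla subr0 mul1e mul0e adde0. Qed.

Lemma nabla1 f g : nabla 1%R f g = g.
Proof. by apply/funext => x; rewrite /nabla subrr mul1e mul0e add0e. Qed.

Definition convex_family C := forall f g (s : R), C f -> C g ->
  (0 <= s <= 1)%R -> C (nabla s f g).

Definition pointwise_convex C Phi := forall f g (s : R), C f -> C g ->
  (0 <= s <= 1)%R ->
  forall x, Phi (nabla s f g) x <= nabla s (Phi f) (Phi g) x.

Definition pointwise_concave C Phi := forall f g (s : R), C f -> C g ->
  (0 <= s <= 1)%R ->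
  forall x, nabla s (Phi f) (Phi g) x <= Phi (nabla s f g) x.

End functionals.
Arguments functionals R H : clear implicits.

(* Subtraction with (+oo) - (+oo) = +oo, i.e., that of the dual extended reals;
   the default addition of \bar R would give -oo. *)
Definition sube {R : realType} (x y : \bar R) : \bar R := (x - y)%dE.

Lemma sube_pinfty {R : realType} : sube +oo%E +oo%E = +oo%E :> \bar R.
Proof. by []. Qed.

Lemma sube_fin {R : realType} (r s : R) : sube r%:E s%:E = (r - s)%:E.
Proof. by []. Qed.

Section constants.
Context {R : realType}.
Implicit Types a l : R.

Definition m_coef a l : R :=
  (1 - l) ^+ 2 * ((1 - a `^ (l / (1 - l))) / (1 - a))
  + l ^+ 2 * ((1 - (1 - a) `^ ((1 - l) / l)) / a).

Definition M_coef a l : R := (1 - l) / (1 - a) + l / a - m_coef a l.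

End constants.

Section nu.
Context {R : realType}.
Local Notation mu := (@lebesgue_measure R).

Let nu_pdfT (l t : R) : R :=
  (1 - l) * (1 - t) `^ ((1 - 2 * l) / l) + l * t `^ ((2 * l - 1) / (1 - l)).

(* A negative power may be singular at 0 or 1, where powR takes the value 0;
   this is a Lebesgue-null set. *)
Definition nu_pdf (l : R) : R -> R := nu_pdfT l \_ `[0, 1].

Definition nu (l : R) : set (measurableTypeR R) -> \bar R :=
  fun A => (\int[mu]_(t in A) (nu_pdf l t)%:E)%E.

Variable l : R.

Lemma measurable_nu_pdf : measurable_fun [set: R] (nu_pdf l).
Proof.
apply/measurable_restrict => //; apply: measurable_funTS.
apply: measurable_funD; apply: measurable_funM => //.
apply: (measurableT_comp (measurable_powR _)).
exact: measurable_funB.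
Qed.

Hypothesis l01 : 0 < l < 1.

Lemma nu_pdf_ge0 t : 0 <= nu_pdf l t.
Proof.
have /andP[l0 l1] := l01.
apply: restrict_ge0 => {}t _; rewrite addr_ge0// mulr_ge0 ?powR_ge0//.
- by rewrite subr_ge0 ltW.
- exact: ltW.
Qed.

Let nu0 : nu l set0 = 0%E.
Proof. by rewrite /nu integral_set0. Qed.

Let nu_ge0 A : (0 <= nu l A)%E.
Proof. by rewrite /nu integral_ge0//= => x _; rewrite lee_fin nu_pdf_ge0. Qed.

Let nu_sigma_additive : semi_sigma_additive (nu l).
Proof.
move=> /= F mF tF mUF; rewrite /nu; apply: cvg_toP.
  apply: ereal_nondecreasing_is_cvgn => m n mn.
  apply: lee_sum_nneg_natr => // k _ _; apply: integral_ge0 => /= x Fkx.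
  by rewrite lee_fin nu_pdf_ge0.
rewrite ge0_integral_bigcup//=.
- apply/measurable_funTS/measurableT_comp => //.
  exact: measurable_nu_pdf.
- by move=> x _; rewrite lee_fin nu_pdf_ge0.
Qed.

HB.instance Definition _ := isMeasure.Build _ _ _
  (nu l) nu0 nu_ge0 nu_sigma_additive.

Let b := (1 - l) / l.
Let c := l / (1 - l).
Let F (t : R) := (1 - l) * t `^ c - l * (1 - t) `^ b.

Let b_gt0 : 0 < b.
Proof. by have /andP[l0 l1] := l01; rewrite divr_gt0// subr_gt0. Qed.

Let c_gt0 : 0 < c.
Proof. by have /andP[l0 l1] := l01; rewrite divr_gt0// subr_gt0. Qed.

Let dF (t : R) : 0 < t < 1 -> is_derive t 1 F (nu_pdfT l t).
Proof.
move=> /andP[t0 t1]; have /andP[l0 l1] := l01.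
have l_neq0 : l != 0 by rewrite gt_eqF.
have l1_neq0 : 1 - l != 0 by rewrite gt_eqF// subr_gt0.
have t1_gt0 : 0 < 1 - t by rewrite subr_gt0.
have D1 : is_derive t 1 (fun t : R => 1 - t) (-1).
  have := is_deriveB (is_derive_cst (1 : R) t 1) (is_derive_id t 1).
  by rewrite sub0r.
have D2 : is_derive t 1 (fun t : R => (1 - t) `^ b) (- (b * (1 - t) `^ (b - 1))).
  have := @is_derive1_comp _ (fun u : R => u `^ b) (fun t : R => 1 - t) t _ _
    (is_derive1_powR b t1_gt0) D1.
  by rewrite mulrN1.
have D3 := is_derive1_powR c t0.
have := is_deriveB (is_deriveZ (1 - l) D3) (is_deriveZ l D2).
move=> /is_derive_eq; apply.
rewrite /nu_pdfT /GRing.scale/=.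
rewrite (_ : b - 1 = (1 - 2 * l) / l); last by rewrite /b; field.
rewrite (_ : c - 1 = (2 * l - 1) / (1 - l)); last by rewrite /c; field.
by rewrite /b /c; field; rewrite l_neq0.
Qed.

Let e (n : nat) : R := n.+2%:R^-1.

Let e_gt0 n : 0 < e n. Proof. by rewrite invr_gt0. Qed.

Let e_lt n : e n < 1 - e n \/ e n = 1 - e n.
Proof.
have : e n <= 2^-1 by rewrite lef_pV2 ?posrE// ler_nat.
rewrite le_eqVlt => /predU1P[->|h]; [right|left]; lra.
Qed.

Let cvg_e : e n @[n --> \oo] --> 0.
Proof. by have := @cvg_harmonic R; rewrite -(cvg_shiftS (harmonic : R^nat)). Qed.

Let cvg_powe (p : R) : 0 < p -> (e n) `^ p @[n --> \oo] --> 0.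
Proof.
move=> p0; have /cvg_at_rightP := powR_cvg0 p0; apply; split => //.
Qed.

Let continuous_powR1 (p : R) (t : R) : 0 < t ->
  (u `^ p) @[u --> t] --> t `^ p.
Proof.
move=> t0; have /derivable1_diffP/differentiable_continuous :
    derivable (fun u : R => u `^ p) t 1.
  by apply: derivable_powR; rewrite in_itv/= andbT.
exact.
Qed.

Let cvg_pow1e (p : R) : (1 - e n) `^ p @[n --> \oo] --> (1 : R).
Proof.
have h : 1 - e n @[n --> \oo] --> (1 : R).
  by rewrite -[X in _ --> X]subr0; apply: cvgB; [exact: cvg_cst|exact: cvg_e].
by have := cvg_comp _ _ h (continuous_powR1 (p := p) ltr01); rewrite powR1.
Qed.

Let continuous_nu_pdfT (t : R) : 0 < t < 1 ->
  nu_pdfT l x @[x --> t] --> nu_pdfT l t.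
Proof.
move=> /andP[t0 t1]; apply: cvgD; apply: cvgM; try exact: cvg_cst.
- have h : 1 - x @[x --> t] --> 1 - t.
    by apply: cvgB; [exact: cvg_cst|exact: cvg_id].
  apply: (cvg_comp _ _ h (continuous_powR1 _)).
  by rewrite subr_gt0.
- exact: continuous_powR1.
Qed.

Let nu_itv n : (\int[mu]_(t in `[e n, (1 - e n)%R]) (nu_pdf l t)%:E
  = (F (1 - e n) - F (e n))%:E)%E.
Proof.
have e0 := e_gt0 n.
case: (e_lt n) => [en|en]; last by rewrite -en subrr set_itv1 integral_set1.
have sub t : e n <= t <= 1 - e n -> 0 < t < 1.
  by move=> /andP[h1 h2]; apply/andP; split; lra.
transitivity (\int[mu]_(t in `[e n, (1 - e n)%R]) (nu_pdfT l t)%:E)%E.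
  apply: eq_integral => t; rewrite inE/= in_itv/= => /sub /andP[t0 t1].
  by rewrite /nu_pdf patchE mem_set//= in_itv/= !ltW.
have cF t : e n <= t <= 1 - e n -> F x @[x --> t] --> F t.
  move=> /sub /dF [] /derivable1_diffP/differentiable_continuous + _.
  exact.
rewrite EFinB; apply: continuous_FTC2 => //.
- apply: continuous_in_subspaceT => t; rewrite inE/= in_itv/= => /sub.
  exact: continuous_nu_pdfT.
- split.
  + by move=> t; rewrite in_itv/= => /andP[h1 h2]; have /sub/dF[] : e n <= t <= 1 - e n by rewrite !ltW.
  + by apply: cvg_at_right_filter; apply: cF; rewrite lexx ltW.
  + by apply: cvg_at_left_filter; apply: cF; rewrite lexx ltW.
- move=> t; rewrite in_itv/= => /andP[h1 h2].
  have /sub/dF[_ <-] : e n <= t <= 1 - e n by rewrite !ltW.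
  by rewrite derive1E.
Qed.

Lemma nu_setT : nu l [set: R] = 1%E.
Proof.
have nd : nondecreasing_seq (fun n => `[e n, 1 - e n]%classic).
  move=> m n mn; rewrite subsetEset => t /=; rewrite !in_itv/= => /andP[h1 h2].
  have : e n <= e m by rewrite lef_pV2 ?posrE// ler_nat !ltnS.
  by move=> h; apply/andP; split; lra.
have bigU : \bigcup_n `[e n, 1 - e n]%classic = `]0, 1[%classic.
  apply/seteqP; split => t /=.
    move=> [n _] /=; rewrite !in_itv/= => /andP[h1 h2].
    by have e0 := e_gt0 n; apply/andP; split; lra.
  rewrite in_itv/= => /andP[t0 t1].
  have t10 : 0 < 1 - t by rewrite subr_gt0.
  have [m hm] : exists n, e n < Num.min t (1 - t).
    have : 0 < Num.min t (1 - t) by rewrite lt_min t0.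
    move=> /(cvgr_lt _ cvg_e) [n _ /(_ n (leqnn n))] ?; by exists n.
  exists m => //=; rewrite in_itv/=.
  by move: hm; rewrite lt_min => /andP[h1 h2]; apply/andP; split; lra.
have h : (\int[mu]_(x in `[e n, (1 - e n)%R]) (nu_pdf l x)%:E @[n --> \oo] -->
    \int[mu]_(x in \bigcup_n `[e n, (1 - e n)%R]%classic) (nu_pdf l x)%:E)%E.
  apply: ge0_nondecreasing_set_cvg_integral => //.
  + move=> n; apply/measurable_EFinP; apply: measurable_funTS.
    exact: measurable_nu_pdf.
  + by move=> n t _ /=; rewrite lee_fin nu_pdf_ge0.
rewrite bigU in h.
have -> : nu l [set: R] = (\int[mu]_(t in `]0%R, 1%R[) (nu_pdf l t)%:E)%E.
  rewrite -(@integral_itv_bndoo _ _ _ _ true false)//; last first.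
    apply/measurable_EFinP; apply: measurable_funTS.
    exact: measurable_nu_pdf.
  rewrite /nu integral_mkcond [RHS]integral_mkcond.
  apply: eq_integral => t _; rewrite !patchE in_setT; case: ifPn => // tn.
  by rewrite /nu_pdf patchE (negbTE tn).
move: h; rewrite (funext nu_itv) => h.
have k : F (1 - e n) - F (e n) @[n --> \oo] -->
    (1 - l) * 1 - l * 0 - ((1 - l) * 0 - l * 1).
  rewrite /F; apply: cvgB; apply: cvgB; (apply: cvgM; first exact: cvg_cst).
  - exact: cvg_pow1e.
  - by under eq_fun do rewrite subKr; exact: cvg_powe.
  - exact: cvg_powe.
  - exact: cvg_pow1e.
have E : (1 - l) * 1 - l * 0 - ((1 - l) * 0 - l * 1) = 1 by ring.
rewrite E in k.
apply: (cvg_unique _ h); first exact: ereal_hausdorff.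
by apply: cvg_EFin => //; exact: nearW.
Qed.

HB.instance Definition _ :=
  @Measure_isProbability.Build _ _ R (nu l) nu_setT.

End nu.

(* Main.v *)
Require Import Defs.
From HB Require Import structures.
From mathcomp Require Import all_boot all_order all_algebra.
From mathcomp Require Import sesquilinear complex.
From mathcomp Require Import all_classical all_reals all_analysis.
From mathcomp Require Import measurable_realfun ring lra.

Import Order.TTheory GRing.Theory Num.Theory.
Import numFieldNormedType.Exports.

Local Open Scope classical_set_scope.
Local Open Scope ring_scope.

(** Fix [f], [g] and [x] and put [phi t := Phi (nabla t f g) x], which is convex
on [0, 1] when [Phi] is pointwise convex, because the segments between points
of a segment are part of it ([nabla_nabla]). Everything is then about one
function of one real variable.

Let [gap t] be the height of the chord over the graph of [phi] at [t]. It is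
concave and vanishes at 0 and 1, hence it lies above the tent
[min (t / a) ((1 - t) / (1 - a))] scaled by [gap a]. On the other hand, on each
side of [a] it lies below the prolongation of the chord of its graph on the
other side of [a], that is, below [max (t / a) ((1 - t) / (1 - a))] times
[gap a] ([gap_bounds]).

It remains to integrate against [nu l]. The mean of [nu l] is [l], so that the
chord integrates to its value at [l] and the integral of [gap] is the middle
term of the theorem; the tent integrates to [m_coef a l]
([integral_nu_tent_min]); and the maximum, being the sum
[t / a + (1 - t) / (1 - a)] minus the minimum, integrates to [M_coef a l]. The
three integrals come from explicit primitives of [t] and [1 - t] times the
density of [nu l].

Infinite values are handled apart. If [phi] is infinite at an endpoint, both
differences are [+oo] and the claim reduces to the positivity of the constants.
If a concave [phi] is infinite at some interior point only, it is so on all of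
]0, 1[ and both differences are [-oo]. The finite concave case is the convex one
for [- phi]. *)

(** * Convex functions on the unit interval *)

Section convex_on_unit_interval.
Context {R : realType}.
Implicit Types (h : R -> R) (a s t w : R).

Definition convex01 h := forall s t w, 0 <= s <= 1 -> 0 <= t <= 1 ->
  0 <= w <= 1 -> h ((1 - w) * s + w * t) <= (1 - w) * h s + w * h t.

Definition gap h t : R := (1 - t) * h 0 + t * h 1 - h t.

Definition tent_min a t : R := Num.min (t / a) ((1 - t) / (1 - a)).

(** This is [Num.max (t / a) ((1 - t) / (1 - a))], in the form that is
integrated once the integral of [tent_min] is known. *)
Definition tent_max a t : R := t / a + (1 - t) / (1 - a) - tent_min a t.

(** This three-point form of convexity is cleared of denominators, so that it
holds also when [s = t] and is directly usable by [lra]. *)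
Lemma convex01_three h s a t : convex01 h -> 0 <= s -> s <= a -> a <= t ->
  t <= 1 -> (t - s) * h a <= (t - a) * h s + (a - s) * h t.
Proof.
move=> ch s0 sa at1 t1.
have [st|] := ltP s t; last first.
  move=> ts; have st : s = t by lra.
  have -> : a = t by lra.
  rewrite st; lra.
have ts0 : 0 < t - s by rewrite subr_gt0.
pose w := (a - s) / (t - s).
have w01 : 0 <= w <= 1.
  rewrite /w divr_ge0 ?subr_ge0//=; last exact: ltW.
  by rewrite ler_pdivrMr// mul1r lerD2r.
have wE : w * (t - s) = a - s by rewrite /w divfK// gt_eqF.
have aE : (1 - w) * s + w * t = a by lra.
have := ch s t w; rewrite aE => /(_ _ _ w01) H.
have {}H : h a <= (1 - w) * h s + w * h t by apply: H; lra.
have := ler_wpM2r (ltW ts0) H.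
have -> : ((1 - w) * h s + w * h t) * (t - s) =
  ((t - s) - w * (t - s)) * h s + w * (t - s) * h t by ring.
by rewrite wE; lra.
Qed.

Lemma gap_ge0 h t : convex01 h -> 0 <= t <= 1 -> 0 <= gap h t.
Proof.
move=> ch /andP[t0 t1]; have := convex01_three h 0 t 1 ch (lexx 0) t0 t1 (lexx 1).
by rewrite /gap; lra.
Qed.

Lemma measurable_tent_min a : measurable_fun [set: R] (tent_min a).
Proof.
apply: measurable_minr; apply: measurable_funM => //.
exact: measurable_funB.
Qed.

Lemma tent_min_ge0 a : 0 < a < 1 -> {in `[0, 1], forall t, 0 <= tent_min a t}.
Proof.
move=> /andP[a0 a1] t; rewrite in_itv/= => /andP[t0 t1].
by rewrite /tent_min le_min !divr_ge0// ?subr_ge0// ltW.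
Qed.

Lemma tent_min_left a t : 0 < a < 1 -> t <= a -> tent_min a t = t / a.
Proof.
move=> /andP[a0 a1] ta; have a'0 : 0 < 1 - a by rewrite subr_gt0.
by apply/min_idPl; rewrite ler_pdivrMr// mulrAC ler_pdivlMr//; nra.
Qed.

Lemma tent_min_right a t : 0 < a < 1 -> a <= t ->
  tent_min a t = (1 - t) / (1 - a).
Proof.
move=> /andP[a0 a1] ta; have a'0 : 0 < 1 - a by rewrite subr_gt0.
by apply/min_idPr; rewrite ler_pdivrMr// mulrAC ler_pdivlMr//; nra.
Qed.

(** On the left of [a], the lower bound is convexity on [0, a] and the upper
bound is convexity at [a] between [t] and 1, that is, the prolongation to [t] of
the chord on [a, 1]. The right of [a] is symmetric. *)
Lemma gap_bounds h a t : convex01 h -> 0 < a < 1 -> 0 <= t <= 1 ->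
  tent_min a t * gap h a <= gap h t <= tent_max a t * gap h a.
Proof.
move=> ch a01 /andP[t0 t1]; have /andP[a0 a1] := a01.
have a'0 : 0 < 1 - a by rewrite subr_gt0.
rewrite /tent_max; have [ta|/ltW at'] := leP t a.
- rewrite tent_min_left//.
  have -> : t / a + (1 - t) / (1 - a) - t / a = (1 - t) / (1 - a) by lra.
  rewrite !(mulrAC _ _^-1) ler_pdivrMr// ler_pdivlMr//; apply/andP; split.
  + have := convex01_three h 0 t a ch (lexx 0) t0 ta (ltW a1).
    by rewrite /gap; lra.
  + have := convex01_three h t a 1 ch t0 ta (ltW a1) (lexx 1).
    by rewrite /gap; lra.
- rewrite tent_min_right//.
  have -> : t / a + (1 - t) / (1 - a) - (1 - t) / (1 - a) = t / a by lra.
  rewrite !(mulrAC _ _^-1) ler_pdivrMr// ler_pdivlMr//; apply/andP; split.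
  + have := convex01_three h a t 1 ch (ltW a0) at' t1 (lexx 1).
    by rewrite /gap; lra.
  + have := convex01_three h 0 a t ch (lexx 0) (ltW a0) at' t1.
    by rewrite /gap; lra.
Qed.

(** Convexity is used only through the sublevel sets, which are intervals. *)
Lemma measurable_convex01 h : convex01 h ->
  measurable_fun (`[0, 1]%classic : set R) h.
Proof.
move=> ch; apply: (measurability _ (RGenInftyO.measurableE R)).
move=> _ [_ [y ->] <-]; apply: is_interval_measurable => s u /=.
rewrite !in_itv/= => -[/andP[s0 s1] hs] [/andP[u0 u1] hu] t /andP[st tu].
have [su|su] := ltP s u; last first.
  have -> : t = s by lra.
  by rewrite in_itv/= s0 s1.
split; first by rewrite in_itv/= (le_trans s0)//= (le_trans tu).
have su0 : 0 < u - s by rewrite subr_gt0.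
have ht := convex01_three h s t u ch s0 st tu u1.
have zy : Num.max (h s) (h u) < y.
  by rewrite gt_max hs hu.
apply: le_lt_trans zy; rewrite -(ler_pM2l su0); apply: le_trans ht _.
have := ler_wpM2l (_ : 0 <= u - t) (_ : h s <= Num.max (h s) (h u)).
have := ler_wpM2l (_ : 0 <= t - s) (_ : h u <= Num.max (h s) (h u)).
rewrite !subr_ge0 st tu !le_max !lexx orbT => /(_ isT isT) + /(_ isT isT).
lra.
Qed.

(** The chord bounds [h] from above; applied at [1 - t], it also bounds [h] from
below, since [h 2^-1] is at most the average of [h t] and [h (1 - t)]. *)
Lemma convex01_bounded h : convex01 h ->
  [bounded h t | t in (`[0, 1]%classic : set R)].
Proof.
move=> ch.
pose B := `|h 0| + `|h 1| + 2 * `|h 2^-1|.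
exists B; split; first exact: num_real.
move=> x Bx t /=; rewrite in_itv/= => /andP[t0 t1].
apply: le_trans (ltW Bx).
have mulle (u r : R) : 0 <= u -> u <= 1 -> u * r <= `|r|.
  move=> u0 u1; apply: le_trans (ler_wpM2l u0 (ler_norm r)) _.
  by rewrite ler_piMl.
have chord (u : R) : 0 <= u -> u <= 1 -> h u <= `|h 0| + `|h 1|.
  move=> u0 u1; have := gap_ge0 h u ch; rewrite u0 u1 => /(_ isT).
  have := mulle (1 - u) (h 0); have := mulle u (h 1) u0 u1.
  rewrite subr_ge0 u1 lerBlDr lerDl u0 => + /(_ isT isT).
  by rewrite /gap; lra.
have t'0 : 0 <= 1 - t by rewrite subr_ge0.
have t'1 : 1 - t <= 1 by rewrite lerBlDr lerDl.
have h2 : h 2^-1 <= (1 - 2^-1) * h t + 2^-1 * h (1 - t).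
  have half : (1 - 2^-1) * t + 2^-1 * (1 - t) = 2^-1 :> R by field.
  by rewrite -{1}half; apply: ch; lra.
have := chord t t0 t1; have := chord (1 - t) t'0 t'1.
have := ler_norm (- h 2^-1); have := normr_ge0 (h 2^-1).
rewrite normrN /B ler_norml => *; apply/andP; split; lra.
Qed.

End convex_on_unit_interval.

(** * The fundamental theorem of calculus on an open interval *)

Section improper_ftc.
Context {R : realType}.
Local Notation mu := (@lebesgue_measure R).

(** The density of [nu l] may be unbounded near 0 and 1, so only the primitive
is required to be continuous up to the endpoints: the theorem on compact
intervals is applied to an exhaustion of ]p, q[, and monotone convergence does
the rest, which is why [g] is nonnegative. *)
Lemma ge0_integral_oo_FTC2 (p q : R) (g G : R -> R) : p < q ->
  {in `]p, q[, forall t, 0 <= g t} -> {in `]p, q[, continuous g} ->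
  {in `]p, q[, forall t : R, is_derive t 1 G (g t)} ->
  {within `[p, q], continuous G} ->
  (\int[mu]_(t in `]p, q[) (g t)%:E = (G q - G p)%:E)%E.
Proof.
move=> pq g0 cg dG /(continuous_within_itvP _ pq)[cG Gp Gq].
have qp0 : 0 < q - p by rewrite subr_gt0.
(* the 3 in [n.+3] keeps [p + e n < q - e n] from the first interval on *)
pose e (n : nat) : R := (q - p) * n.+3%:R^-1.
have e0 n : 0 < e n by rewrite mulr_gt0.
have e3 n : e n * 3 <= q - p.
  by rewrite /e -mulrA ler_piMr ?(ltW qp0)// ler_pdivrMl// mulr1 ler_nat.
have elt n : p + e n < q - e n by have := e3 n; have := e0 n; lra.
have cvge : e n @[n --> \oo] --> 0.
  rewrite -(mulr0 (q - p)); apply: cvgM; first exact: cvg_cst.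
  have := @cvg_harmonic R.
  rewrite -(cvg_shiftS (harmonic : R^nat)).
  by rewrite -(cvg_shiftS (fun n => (harmonic : R^nat) n.+1)).
have sub n t : t \in `[p + e n, q - e n] -> t \in `]p, q[.
  by rewrite !in_itv/= => /andP[h1 h2]; have := e0 n; lra.
have dcG t : t \in `]p, q[ -> {for t, continuous G}.
  by move=> /dG[] /derivable1_diffP/differentiable_continuous.
have compact_part n : (\int[mu]_(t in `[(p + e n)%R, (q - e n)%R]) (g t)%:E
    = (G (q - e n) - G (p + e n))%:E)%E.
  rewrite EFinB; apply: continuous_FTC2 => //.
  - apply: continuous_in_subspaceT => t; rewrite inE/= => /sub; exact: cg.
  - split.
    + by move=> t /subset_itv_oo_cc/sub/dG[].
    + by apply: cvg_at_right_filter; apply/dcG/(sub n); rewrite in_itv/= lexx ltW.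
    + by apply: cvg_at_left_filter; apply/dcG/(sub n); rewrite in_itv/= lexx ltW.
  - by move=> t /subset_itv_oo_cc/sub/dG[_ <-]; rewrite derive1E.
have bigU : \bigcup_n `[p + e n, q - e n]%classic = `]p, q[%classic.
  apply/seteqP; split => t /=; first by move=> [n _] /sub.
  rewrite in_itv/= => /andP[pt tq].
  have : 0 < Num.min (t - p) (q - t) by rewrite lt_min !subr_gt0 pt.
  move=> /(cvgr_lt _ cvge) [n _ /(_ n (leqnn n))] /= hn.
  exists n => //=; rewrite in_itv/=.
  by move: hn; rewrite lt_min => /andP[h1 h2]; apply/andP; split; lra.
have nd : nondecreasing_seq (fun n => `[p + e n, q - e n]%classic).
  move=> m n mn; rewrite subsetEset => t /=; rewrite !in_itv/= => /andP[h1 h2].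
  have : e n <= e m by rewrite ler_pM2l// lef_pV2 ?posrE// ler_nat !ltnS.
  by move=> h; apply/andP; split; lra.
have mg : measurable_fun (`]p, q[%classic : set R) g.
  apply: open_continuous_measurable_fun => //.
  by move=> t; rewrite inE/= => /cg.
have lhs : (\int[mu]_(x in `[(p + e n)%R, (q - e n)%R]) (g x)%:E
    @[n --> \oo] -->
    \int[mu]_(x in \bigcup_n `[(p + e n)%R, (q - e n)%R]%classic) (g x)%:E)%E.
  apply: ge0_nondecreasing_set_cvg_integral => //.
  - move=> n; apply/measurable_EFinP; apply: measurable_funS mg => //.
    by move=> t /sub.
  - by move=> n t /sub /g0; rewrite lee_fin.
rewrite bigU in lhs.
rewrite (funext compact_part) in lhs.
apply: (cvg_unique _ lhs); first exact: ereal_hausdorff.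
apply: cvg_EFin; first exact: nearW.
apply: cvgB.
- move/cvg_at_leftP : Gq; apply; split => [n|]; first by rewrite gtrBl.
  by rewrite -[X in _ --> X]subr0; apply: cvgB => //; exact: cvg_cst.
- move/cvg_at_rightP : Gp; apply; split => [n|]; first by rewrite ltrDl.
  by rewrite -[X in _ --> X]addr0; apply: cvgD => //; exact: cvg_cst.
Qed.

(** A globally continuous extension of [x `^ r] for [0 < r]: with an argument
[x < 0], the power [x `^ r] is 1, hence discontinuous at 0. *)
Definition powR_norm (r x : R) : R := `|x| `^ r.

Lemma powR_normE (r x : R) : 0 <= x -> powR_norm r x = x `^ r.
Proof. by move=> x0; rewrite /powR_norm ger0_norm. Qed.

Lemma continuous_powR_norm (r : R) : 0 < r -> continuous (powR_norm r).
Proof.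
move=> r0 x; have [->|x0] := eqVneq x 0.
  rewrite /continuous_at /powR_norm normr0 powR0 ?gt_eqF//.
  apply/cvgr0Pnorm_lt => eps eps0.
  near=> y.
  rewrite ger0_norm ?powR_ge0//.
  have -> : eps = (eps `^ r^-1) `^ r.
    by rewrite -powRrM mulVf ?gt_eqF// powRr1// ltW.
  rewrite gt0_ltr_powR ?nnegrE ?powR_ge0//.
  near: y; apply: (@cvgr0_norm_lt _ _ _ _ _ id) => //.
  by rewrite powR_gt0.
rewrite /powR_norm; have nx0 : 0 < `|x| by rewrite normr_gt0.
apply: (cvg_comp _ (fun y : R => y `^ r) (@norm_continuous R R x)).
have /derivable1_diffP/differentiable_continuous :
    derivable (fun u : R => u `^ r) `|x| 1.
  by apply: derivable_powR; rewrite in_itv/= andbT.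
exact.
Unshelve. all: by end_near. Qed.

Lemma mulr_powR (t r : R) : 0 < t -> t * t `^ (r - 1) = t `^ r.
Proof.
move=> t0; rewrite -{1}(powRr1 (ltW t0)) -powRD.
  by rewrite addrC subrK.
by rewrite (gt_eqF t0) implybT.
Qed.

End improper_ftc.

(** * The measure [nu] and its density *)

Section nu_density.
Context {R : realType} {l : R} (l01 : 0 < l < 1).
Local Notation mu := (@lebesgue_measure R).

(* the measure structure of [nu l] depends on the proof [l01] *)
Let nuP : probability (measurableTypeR R) R :=
  Defs_nu__canonical__probability_measure_Probability l01.

Lemma nu_dominated : nuP `<< mu.
Proof.
apply/null_content_dominatesP => A mA muA0.
by rewrite /= /nu null_set_integral//; apply/measurable_EFinP/measurable_funTS;
  exact: measurable_nu_pdf.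
Qed.

(** The Radon-Nikodym derivative of [nu l], for which the change of variables is
known, agrees with [nu_pdf l] almost everywhere. That change of variables is
about functions that are nonnegative everywhere, whence the restriction of [f]
to [D]. *)
Lemma integral_nu (f : R -> \bar R) (D : set (measurableTypeR R)) :
  measurable D -> measurable_fun D f -> (forall x, D x -> (0 <= f x)%E) ->
  (\int[nu l]_(x in D) f x = \int[mu]_(x in D) (f x * (nu_pdf l x)%:E))%E.
Proof.
move=> mD mf f0.
have fD x : (0 <= (f \_ D) x)%E.
  by rewrite patchE; case: ifPn => // /set_mem /f0.
have mfD : measurable_fun D (f \_ D).
  by apply: (eq_measurable_fun f) => // x xD; rewrite patchE xD.
have patch_id x : x \in D -> (f \_ D) x = f x by rewrite patchE => ->.
transitivity (\int[nuP]_(x in D) (f \_ D) x)%E.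
  by apply: (@eq_integral _ _ _ nuP) => x /patch_id ->.
rewrite -(Radon_Nikodym_SigmaFinite.change_of_variables nu_dominated)//.
transitivity (\int[mu]_(x in D) ((f \_ D) x * (nu_pdf l x)%:E))%E; last first.
  by apply: eq_integral => x /patch_id ->.
have mRN := Radon_Nikodym_SigmaFinite.f_integrable nu_dominated.
have mpdf : measurable_fun (setT : set (measurableTypeR R)) (EFin \o nu_pdf l).
  by apply/measurable_EFinP; exact: measurable_nu_pdf.
apply: ae_eq_integral => //.
- apply: emeasurable_funM => //; apply: measurable_funTS.
  exact: measurable_int mRN.
- by apply: emeasurable_funM => //; exact: measurable_funTS.
- apply: ae_eqe_mul2l; apply: (ae_eq_subset (@subsetT _ D)).
  apply: integral_ae_eq => // E _ mE.
  by rewrite -(Radon_Nikodym_SigmaFinite.f_integral nu_dominated).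
Qed.

Lemma nu_itv01 : nuP `[0%R, 1%R]%classic = 1%E.
Proof.
rewrite -(nu_setT l01) /= /nu [LHS]integral_mkcond; apply: eq_integral => t _.
by rewrite /nu_pdf !patchE; case: ifPn => // ->.
Qed.

(** The endpoints are negligible, but [phi] may be finite and negative there, so
the integral is compared with that of a constant almost everywhere. *)
Lemma integral_nu_pinfty_oo (phi : R -> \bar R) :
  (forall t, 0 < t < 1 -> phi t = +oo%E) ->
  (\int[nu l]_(t in `[0%R, 1%R]) phi t = +oo)%E.
Proof.
move=> phi_oo.
have m01 : measurable_fun (`[0, 1]%classic : set R) phi.
  apply/(emeasurable_fun_itv_obnd_cbndP 0 (BRight 1)).
  apply/(emeasurable_fun_itv_bndo_bndcP (BRight 0) 1).
  apply: (eq_measurable_fun (cst +oo%E)) => //.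
  by move=> t; rewrite inE/= in_itv/= => /phi_oo ->.
transitivity (\int[nuP]_(t in `[0%R, 1%R]) cst +oo t)%E; last first.
  by rewrite integral_cst// [X in (_ * X)%E]nu_itv01 mule1.
apply: (@ae_eq_integral _ _ _ nuP) => //.
exists [set 0; 1]; split => //.
- exact: measurableU.
- apply: ((null_content_dominatesP _ _).1 nu_dominated).
  + exact: measurableU.
  + by apply: countable_lebesgue_measure0; exact: finite_set_countable.
- move=> t /=; apply: contra_notP => /not_orP[t0 t1].
  rewrite in_itv/= => /andP[t0' t1']; apply: phi_oo.
  by rewrite !lt_neqAle t0' t1' eq_sym !andbT; apply/andP; split; apply/eqP.
Qed.

End nu_density.

(** * First moments of [nu] *)

Section nu_partial_moments.
Context {R : realType} {l : R} (l01 : 0 < l < 1).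
Local Notation mu := (@lebesgue_measure R).

Let l0 : 0 < l. Proof. by case/andP: l01. Qed.

Let l'0 : 0 < 1 - l. Proof. by rewrite subr_gt0; case/andP: l01. Qed.

Let l_neq0 : l != 0. Proof. by rewrite gt_eqF. Qed.

Let l'_neq0 : 1 - l != 0. Proof. by rewrite gt_eqF. Qed.

Let c := l / (1 - l).

Let b := (1 - l) / l.

Let b0 : 0 < b. Proof. by rewrite divr_gt0. Qed.

Let c0 : 0 < c. Proof. by rewrite divr_gt0. Qed.

Let dens (t : R) := (1 - l) * (1 - t) `^ (b - 1) + l * t `^ (c - 1).

Let dens_ge0 t : 0 <= dens t.
Proof. by rewrite addr_ge0// mulr_ge0 ?powR_ge0 ?(ltW l0) ?(ltW l'0). Qed.

Let nu_pdf_dens t : 0 < t < 1 -> nu_pdf l t = dens t.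
Proof.
move=> /andP[t0 t1].
rewrite /nu_pdf patchE mem_set/=; last by rewrite in_itv/= !ltW.
rewrite /dens /b /c; congr (_ * _ `^ _ + _ * _ `^ _); field;
  rewrite ?l_neq0 ?l'_neq0//.
Qed.

Let is_derive_powR_norm r (t : R) : 0 < t ->
  is_derive t (1 : R) (powR_norm r) (r * t `^ (r - 1)).
Proof.
move=> t0; apply: near_eq_is_derive (is_derive1_powR r t0).
near=> x; rewrite powR_normE// ltW//; near: x; exact: lt_nbhsr.
Unshelve. all: by end_near. Qed.

Let is_derive_powR_norm1B r (t : R) : t < 1 ->
  is_derive t (1 : R) (fun x : R => powR_norm r (1 - x))
    (- (r * (1 - t) `^ (r - 1))).
Proof.
move=> t1; have t'0 : 0 < 1 - t by rewrite subr_gt0.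
have D1 : is_derive t (1 : R) (fun t : R => 1 - t) (-1).
  have := is_deriveB (is_derive_cst (1 : R) t (1 : R)) (is_derive_id t (1 : R)).
  by rewrite sub0r.
have := @is_derive1_comp _ (powR_norm r) (fun t : R => 1 - t) t _ _
  (is_derive_powR_norm r _ t'0) D1.
by rewrite mulrN1.
Qed.

Let continuous_powR_norm1B (r : R) : 0 < r ->
  continuous (fun x : R => powR_norm r (1 - x)).
Proof.
move=> r0 x; have h : (1 - y) @[y --> x] --> 1 - x.
  by apply: cvgB; [exact: cvg_cst|exact: cvg_id].
exact: (cvg_comp _ _ h (@continuous_powR_norm R r r0 (1 - x))).
Qed.

Let continuous_dens (t : R) : 0 < t < 1 -> {for t, continuous dens}.
Proof.
have cont r (u : R) : 0 < u -> {for u, continuous (fun x : R => x `^ r)}.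
  move=> u0; have [/derivable1_diffP/differentiable_continuous + _] :=
    is_derive1_powR r u0.
  exact.
move=> /andP[t0 t1]; apply: cvgD; apply: cvgM; try exact: cvg_cst.
- have h : (1 - y) @[y --> t] --> 1 - t.
    by apply: cvgB; [exact: cvg_cst|exact: cvg_id].
  by apply: (cvg_comp _ (fun y : R => y `^ _) h (cont _ _ _)); rewrite subr_gt0.
- exact: cont.
Qed.

(** It is meant for [k t] equal to [t] or [1 - t], for which a primitive [K] can
be written with positive powers of [t] and [1 - t] only. *)
Let integral_nu_oo (k K : R -> R) (p q : R) : 0 <= p -> p < q -> q <= 1 ->
  {in `]p, q[, forall t, 0 <= k t} -> continuous k -> continuous K ->
  {in `]p, q[, forall t : R, is_derive t (1 : R) K (k t * dens t)} ->
  (\int[nu l]_(t in `]p, q[) (k t)%:E = (K q - K p)%:E)%E.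
Proof.
move=> p0 pq q1 k0 ck cK dK.
have sub t : t \in `]p, q[ -> 0 < t < 1.
  by rewrite in_itv/= => /andP[pt tq]; apply/andP; split; lra.
rewrite integral_nu//; last first.
  apply/measurable_EFinP/measurable_funTS.
  exact: continuous_measurable_fun.
transitivity (\int[mu]_(t in `]p, q[) (k t * dens t)%:E)%E.
  by apply: eq_integral => t; rewrite inE/= => /sub/nu_pdf_dens ->.
apply: ge0_integral_oo_FTC2 => //.
- by move=> t tpq; rewrite mulr_ge0// k0.
- by move=> t /sub/continuous_dens cd; apply: cvgM cd; exact: ck.
- exact: continuous_subspaceT.
Qed.

Let contZ (r : R) (f : R -> R) : continuous f -> continuous (fun t => r * f t).
Proof. by move=> cf t; apply: cvgM; [exact: cvg_cst|exact: cf]. Qed.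

Let contD (f g : R -> R) :
  continuous f -> continuous g -> continuous (fun t => f t + g t).
Proof. by move=> cf cg t; apply: cvgD; [exact: cf|exact: cg]. Qed.

Let contB (f g : R -> R) :
  continuous f -> continuous g -> continuous (fun t => f t - g t).
Proof. by move=> cf cg t; apply: cvgB; [exact: cf|exact: cg]. Qed.

(** The primitive is found by integrating [t * dens t] by parts, then writing
[t * (1 - t) `^ b] as [(1 - t) `^ b - (1 - t) `^ (b + 1)]; the coefficients
simplify since [b + 1 = l^-1] and [c + 1 = (1 - l)^-1]. *)
Lemma integral_nu_id p q : 0 <= p -> p < q -> q <= 1 ->
  let G t := l * (1 - l) * t `^ (c + 1) + l * (1 - l) * (1 - t) `^ (b + 1)
    - l * (1 - t) `^ b in
  (\int[nu l]_(t in `]p, q[) t%:E = (G q - G p)%:E)%E.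
Proof.
move=> p0 pq q1 G.
pose G' t := l * (1 - l) * powR_norm (c + 1) t
    + l * (1 - l) * powR_norm (b + 1) (1 - t)
    - l * powR_norm b (1 - t).
have GE t : 0 <= t <= 1 -> G t = G' t.
  by move=> /andP[t0 t1]; rewrite /G /G' !powR_normE// subr_ge0.
rewrite !GE; [|lra..].
apply: (@integral_nu_oo id G' p q p0 pq q1).
- by move=> t; rewrite in_itv/= => /andP[+ _]; move/ltW; exact: le_trans.
- by move=> t; exact: cvg_id.
- have c1 : 0 < c + 1 by rewrite addr_gt0.
  have b1 : 0 < b + 1 by rewrite addr_gt0.
  exact: (contB _ _ (contD _ _ (contZ _ _ (continuous_powR_norm _ c1))
    (contZ _ _ (continuous_powR_norm1B _ b1)))
    (contZ _ _ (continuous_powR_norm1B _ b0))).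
- move=> t; rewrite in_itv/= => /andP[pt tq].
  have t0 : 0 < t by lra.
  have t1 : t < 1 by lra.
  have t'0 : 0 < 1 - t by lra.
  have := is_deriveB (is_deriveD
    (is_deriveZ (l * (1 - l)) (is_derive_powR_norm (c + 1) _ t0))
    (is_deriveZ (l * (1 - l)) (is_derive_powR_norm1B (b + 1) _ t1)))
    (is_deriveZ l (is_derive_powR_norm1B b _ t1)).
  move=> /is_derive_eq; apply.
  rewrite /GRing.scale/= !addrK /dens mulrDr.
  rewrite -(mulr_powR _ c t0) -(mulr_powR _ b t'0).
  by rewrite /b /c; field; rewrite ?l_neq0 ?l'_neq0//.
Qed.

(** The primitive is that of [dens], namely
[(1 - l) * t `^ c - l * (1 - t) `^ b], minus the one of [integral_nu_id]. *)
Lemma integral_nu_onem p q : 0 <= p -> p < q -> q <= 1 ->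
  let K t := (1 - l) * t `^ c - l * (1 - l) * t `^ (c + 1)
    - l * (1 - l) * (1 - t) `^ (b + 1) in
  (\int[nu l]_(t in `]p, q[) (1 - t)%:E = (K q - K p)%:E)%E.
Proof.
move=> p0 pq q1 K.
pose K' t := (1 - l) * powR_norm c t - l * (1 - l) * powR_norm (c + 1) t
    - l * (1 - l) * powR_norm (b + 1) (1 - t).
have KE t : 0 <= t <= 1 -> K t = K' t.
  by move=> /andP[t0 t1]; rewrite /K /K' !powR_normE// subr_ge0.
rewrite !KE; [|lra..].
apply: (@integral_nu_oo (fun t => 1 - t) K' p q p0 pq q1).
- move=> t; rewrite in_itv/= subr_ge0 => /andP[_ /ltW tq].
  exact: le_trans tq q1.
- by move=> t; apply: cvgB; [exact: cvg_cst|exact: cvg_id].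
- have c1 : 0 < c + 1 by rewrite addr_gt0.
  have b1 : 0 < b + 1 by rewrite addr_gt0.
  exact: (contB _ _ (contB _ _ (contZ _ _ (continuous_powR_norm _ c0))
    (contZ _ _ (continuous_powR_norm _ c1)))
    (contZ _ _ (continuous_powR_norm1B _ b1))).
- move=> t; rewrite in_itv/= => /andP[pt tq].
  have t0 : 0 < t by lra.
  have t1 : t < 1 by lra.
  have t'0 : 0 < 1 - t by lra.
  have := is_deriveB (is_deriveB
    (is_deriveZ (1 - l) (is_derive_powR_norm c _ t0))
    (is_deriveZ (l * (1 - l)) (is_derive_powR_norm (c + 1) _ t0)))
    (is_deriveZ (l * (1 - l)) (is_derive_powR_norm1B (b + 1) _ t1)).
  move=> /is_derive_eq; apply.
  rewrite /GRing.scale/= !addrK /dens mulrDr.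
  rewrite -(mulr_powR _ c t0) -(mulr_powR _ b t'0).
  by rewrite /b /c; field; rewrite ?l_neq0 ?l'_neq0//.
Qed.

End nu_partial_moments.

Section nu_moments.
Context {R : realType} {l : R} (l01 : 0 < l < 1).
Implicit Types a t : R.
Let nuP : probability (measurableTypeR R) R :=
  Defs_nu__canonical__probability_measure_Probability l01.

Let l0 : 0 < l. Proof. by case/andP: l01. Qed.

Let l'0 : 0 < 1 - l. Proof. by rewrite subr_gt0; case/andP: l01. Qed.

Lemma integral_nu_itv_oo (f : R -> R) (u v : bool) (p q : R) :
  measurable_fun [set: R] f -> {in `[p, q], forall x, 0 <= f x} ->
  (\int[nu l]_(x in [set` Interval (BSide u p) (BSide v q)]) (f x)%:E =
   \int[nu l]_(x in `]p, q[) (f x)%:E)%E.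
Proof.
move=> mf f0.
have mEf (D : set (measurableTypeR R)) : measurable D ->
    measurable_fun D (EFin \o f).
  by move=> mD; apply/measurable_EFinP; exact: measurable_funTS.
rewrite !integral_nu//; [|exact: mEf| |exact: mEf|].
- apply: integral_itv_bndoo; apply: emeasurable_funM; first exact: mEf.
  apply/measurable_EFinP/measurable_funTS; exact: measurable_nu_pdf.
- by move=> x /subset_itv_oo_cc /f0; rewrite lee_fin.
- move=> x xuv; rewrite lee_fin; apply: f0; move: xuv.
  by apply: subset_itv; rewrite bnd_simp.
Qed.

Lemma integral_nu_mean : (\int[nu l]_(t in `[0%R, 1%R]) t%:E = l%:E)%E.
Proof.
rewrite integral_nu_itv_oo//; last by move=> x; rewrite in_itv/= => /andP[].
rewrite (integral_nu_id l01)//; congr EFin.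
rewrite subrr subr0 !powR1 !powR0 ?gt_eqF ?addr_gt0 ?divr_gt0//.
ring.
Qed.

Lemma integral_nu_mean_onem :
  (\int[nu l]_(t in `[0%R, 1%R]) (1 - t)%:E = (1 - l)%:E)%E.
Proof.
rewrite integral_nu_itv_oo//; last 2 first.
- exact: measurable_funB.
- by move=> x; rewrite in_itv/= subr_ge0 => /andP[].
rewrite (integral_nu_onem l01)//; congr EFin.
rewrite subrr subr0 !powR1 !powR0 ?gt_eqF ?addr_gt0 ?divr_gt0//.
ring.
Qed.

(** The tent is [t / a] on the left of [a] and [(1 - t) / (1 - a)] on the right,
so its integral combines one partial moment of each kind. *)
Lemma integral_nu_tent_min a : 0 < a < 1 ->
  (\int[nu l]_(t in `[0%R, 1%R]) (tent_min a t)%:E = (m_coef a l)%:E)%E.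
Proof.
move=> a01; have /andP[a0 a1] := a01; have a'0 : 0 < 1 - a by rewrite subr_gt0.
rewrite (@itv_bndbnd_setU _ _ _ (BLeft a)) ?bnd_simp ?ltW//.
rewrite (@ge0_integral_setU _ _ _ nuP)//=; last 3 first.
- by apply/measurable_EFinP/measurable_funTS; exact: measurable_tent_min.
- move=> x /= xu; rewrite lee_fin tent_min_ge0//.
  by case: xu; rewrite !in_itv/= => /andP[h1 h2]; apply/andP; split; lra.
- rewrite disj_set2E; apply/eqP; apply/seteqP; split => // x [] /=.
  by rewrite !in_itv/= => /andP[_ xa] /andP[ax _]; lra.
rewrite !integral_nu_itv_oo; last 4 first.
- exact: measurable_tent_min.
- move=> x xa; apply: tent_min_ge0 => //.
  by apply: subset_itv xa; rewrite bnd_simp// ltW.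
- exact: measurable_tent_min.
- move=> x xa; apply: tent_min_ge0 => //.
  by apply: subset_itv xa; rewrite bnd_simp// ltW.
have -> : (\int[nu l]_(t in `]0%R, a[) (tent_min a t)%:E =
    a^-1%:E * \int[nu l]_(t in `]0%R, a[) t%:E)%E.
  rewrite -(@ge0_integralZl_EFin _ _ _ nuP)//.
  - apply: (@eq_integral _ _ _ nuP) => t; rewrite inE/= in_itv/= => /andP[_ ta].
    by rewrite tent_min_left// ?ltW// mulrC.
  - by move=> t /=; rewrite in_itv/= lee_fin => /andP[/ltW].
  - by rewrite invr_ge0 ltW.
have -> : (\int[nu l]_(t in `]a, 1%R[) (tent_min a t)%:E =
    (1 - a)^-1%:E * \int[nu l]_(t in `]a, 1%R[) (1 - t)%:E)%E.
  rewrite -(@ge0_integralZl_EFin _ _ _ nuP)//.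
  - apply: (@eq_integral _ _ _ nuP) => t; rewrite inE/= in_itv/= => /andP[ta _].
    by rewrite tent_min_right// ?ltW// mulrC.
  - by move=> t /=; rewrite in_itv/= lee_fin subr_ge0 => /andP[_ /ltW].
  - by apply/measurable_EFinP; exact: measurable_funB.
  - by rewrite invr_ge0 ltW.
rewrite (integral_nu_id l01)// ?ltW// (integral_nu_onem l01)// ?ltW//.
rewrite -!EFinM -EFinD; congr EFin.
rewrite subrr subr0 !powR1 !powR0 ?gt_eqF ?addr_gt0 ?divr_gt0//.
have powRS (x r : R) : 0 < x -> x `^ (r + 1) = x * x `^ r.
  by move=> x0; rewrite -mulr_powR// addrK.
rewrite !powRS// /m_coef.
by field; rewrite ?(gt_eqF a0) ?(gt_eqF a'0).
Qed.

End nu_moments.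

(** * Bounds for real-valued convex functions *)

Section convex_integral.
Context {R : realType} {l : R} (l01 : 0 < l < 1).
Implicit Types (a t : R) (h : R -> R).
Let nuP : probability (measurableTypeR R) R :=
  Defs_nu__canonical__probability_measure_Probability l01.
Local Notation I01 := (`[0, 1]%classic : set (measurableTypeR R)).
Local Notation E h := (\int[nuP]_(t in I01) h t).

Lemma convex01_integrable h : convex01 h -> nuP.-integrable I01 (EFin \o h).
Proof.
move=> ch; apply: measurable_bounded_integrable => //.
- by rewrite ltey_eq fin_num_measure.
- exact: measurable_convex01.
- exact: convex01_bounded.
Qed.

Let id_integrable : nuP.-integrable I01 (EFin \o (fun t => t)).
Proof. by apply: convex01_integrable => *. Qed.

Let onem_integrable : nuP.-integrable I01 (EFin \o (fun t => 1 - t)).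
Proof. by apply: convex01_integrable => s t w *; lra. Qed.

Let tent_integrable a : 0 < a < 1 ->
  nuP.-integrable I01 (EFin \o tent_min a).
Proof.
move=> a01; apply/integrableP; split.
  by apply/measurable_EFinP/measurable_funTS; exact: measurable_tent_min.
have -> : (\int[nuP]_(t in I01) `|(tent_min a t)%:E| =
    \int[nuP]_(t in I01) (tent_min a t)%:E)%E.
  apply: eq_integral => t; rewrite inE/= => t01.
  by rewrite ger0_norm// tent_min_ge0.
by rewrite (integral_nu_tent_min l01)// ltry.
Qed.

Let E_id : E (fun t => t) = l.
Proof. by rewrite /Rintegral (integral_nu_mean l01). Qed.

Let E_onem : E (fun t => 1 - t) = 1 - l.
Proof. by rewrite /Rintegral (integral_nu_mean_onem l01). Qed.

Let E_tent a : 0 < a < 1 -> E (tent_min a) = m_coef a l.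
Proof. by move=> a01; rewrite /Rintegral (integral_nu_tent_min l01). Qed.

Let comb_integrable (x y : R) h : nuP.-integrable I01 (EFin \o h) ->
  nuP.-integrable I01 (EFin \o (fun t => (1 - t) * x + t * y - h t)).
Proof.
move=> ih; apply: (@eq_integrable _ _ _ nuP _ _
  ((fun t => x%:E * (1 - t)%:E + y%:E * t%:E) \- (EFin \o h))%E) => //.
  by move=> t _ /=; rewrite -!EFinM -EFinD [x * _]mulrC [y * _]mulrC.
apply: integrableB => //; apply: integrableD => //; exact: integrableZl.
Qed.

(** Both [gap] and a multiple of [tent_max] have this shape, an affine function
minus an integrable one. *)
Let E_comb (x y : R) h : nuP.-integrable I01 (EFin \o h) ->
  E (fun t => (1 - t) * x + t * y - h t) = (1 - l) * x + l * y - E h.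
Proof.
move=> ih.
have i1 : nuP.-integrable I01 (EFin \o (fun t => (1 - t) * x)).
  by apply: (@eq_integrable _ _ _ nuP _ _ (fun t => (1 - t)%:E * x%:E)%E) => //;
    exact: integrableZr.
have i2 : nuP.-integrable I01 (EFin \o (fun t => t * y)).
  by apply: (@eq_integrable _ _ _ nuP _ _ (fun t => t%:E * y%:E)%E) => //;
    exact: integrableZr.
rewrite RintegralB//; last first.
  by apply: (@eq_integrable _ _ _ nuP _ _ ((EFin \o (fun t => (1 - t) * x)%R)
    \+ (EFin \o (fun t => t * y)%R))%E) => //; exact: integrableD.
by rewrite RintegralD// !RintegralZr// E_id E_onem.
Qed.

(** [gap_bounds], integrated: the middle term is the integral of [gap h]. *)
Lemma convex01_integral_bounds a h : 0 < a < 1 -> convex01 h ->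
  m_coef a l * gap h a <= (1 - l) * h 0 + l * h 1 - E h
    <= M_coef a l * gap h a.
Proof.
move=> a01 ch; have ih := convex01_integrable h ch.
have ic := comb_integrable (h 0) (h 1) _ ih.
rewrite -E_comb//; set D := gap h a.
have iT (r : R) : nuP.-integrable I01 (EFin \o (fun t => tent_min a t * r)).
  apply: (@eq_integrable _ _ _ nuP _ _
    (fun t => (tent_min a t)%:E * r%:E)%E) => //.
  by apply: integrableZr => //; exact: tent_integrable.
have bounds t : I01 t -> tent_min a t * D <= gap h t <= tent_max a t * D.
  by rewrite /= in_itv/=; exact: gap_bounds.
apply/andP; split.
- rewrite -E_tent// -RintegralZr//; last exact: tent_integrable.
  by apply: le_Rintegral => // t /bounds /andP[].
- have -> : M_coef a l * D =
      (1 - l) * (D / (1 - a)) + l * (D / a) - m_coef a l * D.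
    by rewrite /M_coef; ring.
  rewrite -E_tent// -RintegralZr//; last exact: tent_integrable.
  rewrite -E_comb//; apply: le_Rintegral => //; first exact: comb_integrable.
  move=> t /bounds /andP[_]; rewrite /gap => /le_trans; apply.
  by rewrite /tent_max le_eqVlt; apply/orP; left; apply/eqP; ring.
Qed.

End convex_integral.

(** * Extended-real-valued functions *)

Section constants.
Context {R : realType}.
Implicit Types a l : R.

Lemma powR_lt1 (x r : R) : 0 < x < 1 -> 0 < r -> x `^ r < 1.
Proof.
move=> /andP[x0 x1] r0; have -> : (1 : R) = 1 `^ r by rewrite powR1.
by rewrite gt0_ltr_powR// nnegrE// ltW.
Qed.

Lemma m_coef_gt0 a l : 0 < a < 1 -> 0 < l < 1 -> 0 < m_coef a l.
Proof.
move=> /andP[a0 a1] /andP[l0 l1].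
have a'0 : 0 < 1 - a by rewrite subr_gt0.
have l'0 : 0 < 1 - l by rewrite subr_gt0.
rewrite addr_gt0// mulr_gt0 ?exprn_gt0// divr_gt0// subr_gt0 powR_lt1 ?divr_gt0//.
  by rewrite a0.
by rewrite a'0 gtrBl.
Qed.

(** Both terms of [m_coef] are smaller than the matching term of
[(1 - l) / (1 - a) + l / a], as the factorisation in the proof shows. *)
Lemma M_coef_gt0 a l : 0 < a < 1 -> 0 < l < 1 -> 0 < M_coef a l.
Proof.
move=> /andP[a0 a1] /andP[l0 l1].
have a'0 : 0 < 1 - a by rewrite subr_gt0.
have l'0 : 0 < 1 - l by rewrite subr_gt0.
have -> : M_coef a l =
    (1 - l) / (1 - a) * (1 - (1 - l) * (1 - a `^ (l / (1 - l))))
    + l / a * (1 - l * (1 - (1 - a) `^ ((1 - l) / l))).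
  by rewrite /M_coef /m_coef; ring.
have pos (u y : R) : 0 < u -> u < 1 -> 0 < y -> 0 < 1 - u * (1 - y).
  by move=> u0 u1 y0; nra.
by rewrite addr_gt0// mulr_gt0 ?divr_gt0// pos ?powR_gt0// gtrBl.
Qed.

End constants.

Section extended_real_valued.
Context {R : realType} {l : R} (l01 : 0 < l < 1).
Implicit Types (a s t w : R) (phi : R -> \bar R).
Local Open Scope ereal_scope.
Let nuP : probability (measurableTypeR R) R :=
  Defs_nu__canonical__probability_measure_Probability l01.

Definition segment w (x y : \bar R) := (1 - w)%:E * x + w%:E * y.

Definition econvex01 phi := forall s t w, (0 <= s <= 1)%R -> (0 <= t <= 1)%R ->
  (0 <= w <= 1)%R ->
  phi ((1 - w) * s + w * t)%R <= segment w (phi s) (phi t).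

Definition econcave01 phi := forall s t w, (0 <= s <= 1)%R -> (0 <= t <= 1)%R ->
  (0 <= w <= 1)%R ->
  segment w (phi s) (phi t) <= phi ((1 - w) * s + w * t)%R.

Lemma sube_pinftyl (y : \bar R) : sube +oo y = +oo.
Proof. by case: y. Qed.

Lemma segment_pinfty w x y : (0 < w < 1)%R -> x != -oo -> y != -oo ->
  x = +oo \/ y = +oo -> segment w x y = +oo.
Proof.
move=> /andP[w0 w1] xNy yNy; have w'0 : (0 < 1 - w)%R by rewrite subr_gt0.
have mulNy (r : R) z : (0 < r)%R -> z != -oo -> r%:E * z != -oo.
  by case: z => // r0 _; rewrite gt0_muley ?lte_fin.
rewrite /segment => -[->|->]; rewrite gt0_muley ?lte_fin//.
  by rewrite addye// mulNy.
by rewrite addey// mulNy.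
Qed.

Lemma segment_fin w (x y : R) :
  segment w x%:E y%:E = ((1 - w) * x + w * y)%:E.
Proof. by []. Qed.

Section bounds.
Context (a : R) (phi : R -> \bar R) (a01 : (0 < a < 1)%R).
Context (phiNy : forall t, (0 <= t <= 1)%R -> phi t != -oo).

Let D := sube (segment a (phi 0%R) (phi 1%R)) (phi a).

Let J := sube (segment l (phi 0%R) (phi 1%R))
  (\int[nu l]_(t in `[0%R, 1%R]) phi t).

Let phi0Ny : phi 0%R != -oo. Proof. by apply: phiNy; rewrite lexx ler01. Qed.

Let phi1Ny : phi 1%R != -oo. Proof. by apply: phiNy; rewrite lexx ler01. Qed.

Let endpoints : (phi 0%R = +oo \/ phi 1%R = +oo) \/
  (phi 0%R \is a fin_num /\ phi 1%R \is a fin_num).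
Proof.
case: (phi 0%R) phi0Ny => // [x|] _; last by left; left.
by case: (phi 1%R) phi1Ny => // [y|] _; [right|left; right].
Qed.

Let DJ_pinfty : phi 0%R = +oo \/ phi 1%R = +oo -> D = +oo /\ J = +oo.
Proof. by move=> phiy; rewrite /D /J !segment_pinfty// !sube_pinftyl. Qed.

Let DJ_fin (h : R -> R) : nuP.-integrable `[0%R, 1%R] (EFin \o h) ->
  (forall t, (0 <= t <= 1)%R -> phi t = (h t)%:E) ->
  D = (gap h a)%:E /\
  J = ((1 - l) * h 0 + l * h 1 - \int[nuP]_(t in `[0%R, 1%R]) h t)%:E%R.
Proof.
move=> ih phih; have h01 t : t \in `[0%R, 1%R] -> phi t = (h t)%:E.
  by rewrite in_itv/= => /phih.
have /andP[a0 a1] := a01.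
have -> : D = (gap h a)%:E by rewrite /D !phih ?lexx ?ler01 ?ltW.
split=> //; rewrite /J !phih ?lexx ?ler01//.
have -> : \int[nu l]_(t in `[0%R, 1%R]) phi t =
    (\int[nuP]_(t in `[0%R, 1%R]) h t)%R%:E.
  rewrite /Rintegral fineK; last exact: integrable_fin_num.
  by apply: (@eq_integral _ _ _ nuP) => t; rewrite inE/= => /h01.
by [].
Qed.

(** A chord that is finite at both ends forces [phi] to be finite in between. *)
Lemma econvex01_bounds : econvex01 phi ->
  (m_coef a l)%:E * D <= J /\ J <= (M_coef a l)%:E * D.
Proof.
move=> cphi; have [/DJ_pinfty[-> ->]|[/fineK f0 /fineK f1]] := endpoints.
  by rewrite !gt0_muley ?lte_fin ?m_coef_gt0 ?M_coef_gt0.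
pose h t := fine (phi t).
have phih t : (0 <= t <= 1)%R -> phi t = (h t)%:E.
  move=> t01; have := cphi 0%R 1%R t; rewrite !lexx ler01 => /(_ isT isT t01).
  rewrite mulr0 mulr1 add0r -f0 -f1 segment_fin /h => tley.
  by rewrite fineK// fin_numE phiNy//= -ltey (le_lt_trans tley)// ltry.
have ch : convex01 h.
  move=> s t w s01 t01 w01; rewrite -lee_fin -segment_fin -!phih//.
    exact: cphi.
  move: s01 t01 w01 => /andP[? ?] /andP[? ?] /andP[? ?].
  by apply/andP; split; nra.
have [-> ->] := DJ_fin h (convex01_integrable l01 h ch) phih.
by rewrite -!EFinM !lee_fin; apply/andP; exact: convex01_integral_bounds.
Qed.

(** Unlike in the convex case, [phi] may be infinite inside ]0, 1[ while finite
at the endpoints; then it is infinite on the whole of ]0, 1[, since every other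
point of this interval lies strictly between an endpoint and a point where [phi]
is infinite. *)
Lemma econcave01_bounds : econcave01 phi ->
  J <= (m_coef a l)%:E * D /\ (M_coef a l)%:E * D <= J.
Proof.
move=> cphi; have [/DJ_pinfty[-> ->]|[/fineK f0 /fineK f1]] := endpoints.
  by rewrite !gt0_muley ?lte_fin ?m_coef_gt0 ?M_coef_gt0.
have [[u u01 phiu]|finphi] :=
    pselect (exists2 u, (0 <= u <= 1)%R & phi u = +oo).
  have phi_oo t : (0 < t < 1)%R -> phi t = +oo.
    move=> t01.
    have via v w : (0 <= v <= 1)%R -> (0 < w < 1)%R ->
      t = ((1 - w) * u + w * v)%R -> phi t = +oo.
      move=> v01 w01 ->; apply/eqP; rewrite -leye_eq.
      rewrite -(segment_pinfty w (phi u) (phi v))//;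
        [|exact: phiNy|exact: phiNy|by left].
      by apply: cphi => //; case/andP: w01 => ? ?; rewrite !ltW.
    have /andP[u0 u1] := u01; have /andP[t0 t1] := t01.
    have [tu|ut|->//] := ltgtP t u.
    - have u_gt0 : (0 < u)%R := lt_trans t0 tu.
      apply: (via 0%R (1 - t / u)%R); rewrite ?lexx ?ler01//.
        by rewrite subr_gt0 ltr_pdivrMr// mul1r tu gtrBl divr_gt0.
      by field; rewrite (gt_eqF u_gt0).
    - have u'0 : (0 < 1 - u)%R by rewrite subr_gt0 (lt_trans ut).
      apply: (via 1%R ((t - u) / (1 - u))%R); rewrite ?lexx ?ler01//.
        by rewrite divr_gt0 ?u'0 ?subr_gt0//= ltr_pdivrMr// mul1r ltrD2r.
      by field; rewrite (gt_eqF u'0).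
  have D_oo : D = -oo.
    by rewrite /D -f0 -f1 segment_fin (phi_oo _ a01).
  have J_oo : J = -oo.
    rewrite /J -f0 -f1 segment_fin.
    by rewrite (integral_nu_pinfty_oo l01).
  by rewrite D_oo J_oo !gt0_muleNy ?lte_fin ?m_coef_gt0 ?M_coef_gt0.
pose h t := fine (phi t).
have phih t : (0 <= t <= 1)%R -> phi t = (h t)%:E.
  move=> t01; rewrite /h fineK// fin_numE phiNy//=.
  by apply/eqP => phit; apply: finphi; exists t.
have ch : convex01 (fun t => - h t)%R.
  move=> s t w s01 t01 w01; rewrite !mulrN -opprD lerN2.
  rewrite -lee_fin -segment_fin -!phih//; first exact: cphi.
  move: s01 t01 w01 => /andP[? ?] /andP[? ?] /andP[? ?].
  by apply/andP; split; nra.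
have ih : nuP.-integrable `[0%R, 1%R] (EFin \o h).
  apply: (@eq_integrable _ _ _ nuP _ _ (fun t => - (- h t)%:E)) => //.
    by move=> t _ /=; rewrite opprK.
  by apply: integrableN; exact: (convex01_integrable l01).
have [-> ->] := DJ_fin h ih phih.
have := convex01_integral_bounds l01 a _ a01 ch.
have -> : gap (fun t => - h t)%R a = (- gap h a)%R by rewrite /gap; ring.
have -> : (\int[nuP]_(t in `[0%R, 1%R]) (- h t) =
    - \int[nuP]_(t in `[0%R, 1%R]) h t)%R.
  rewrite -[RHS]mulN1r -RintegralZl//; apply: eq_Rintegral => t _.
  by rewrite mulN1r.
rewrite -!EFinM !lee_fin => /andP[]; split; lra.
Qed.

End bounds.
End extended_real_valued.

(** * Functionals along a segment *)

Section functionals_on_segments.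
Context {R : realType} {H : Type}.
Implicit Types (f g : H -> \bar R).

(** In the extended reals distributivity needs the sums to be defined, which is
where [f] and [g] avoiding [-oo] matters; the weights are nonnegative, so that
[(p + q) * f x] also splits when [f x] is infinite. *)
Lemma nabla_nabla f g (s t w : R) : functionals R H f -> functionals R H g ->
  0 <= s <= 1 -> 0 <= t <= 1 -> 0 <= w <= 1 ->
  nabla w (nabla s f g) (nabla t f g) = nabla ((1 - w) * s + w * t) f g.
Proof.
move=> fNy gNy /andP[s0 s1] /andP[t0 t1] /andP[w0 w1].
apply/funext => x; rewrite /nabla.
have s'0 : 0 <= 1 - s by rewrite subr_ge0.
have t'0 : 0 <= 1 - t by rewrite subr_ge0.
have w'0 : 0 <= 1 - w by rewrite subr_ge0.
have adddef (p q : R) : 0 <= p -> 0 <= q -> (p%:E * f x +? q%:E * g x)%E.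
  have mulNy (r : R) (z : \bar R) : 0 <= r -> z != -oo%E -> (r%:E * z != -oo)%E.
    rewrite le_eqVlt => /predU1P[<-|r0]; first by rewrite mul0e.
    by case: z => // _; rewrite gt0_muley ?lte_fin.
  by move=> p0 q0; apply: ltninfty_adde_def; rewrite inE ltNye mulNy//.
rewrite !muleDr ?adddef// !muleA -!EFinM addeACA.
rewrite -!ge0_muleDl ?lee_fin ?mulr_ge0//.
by rewrite -!EFinD; congr (_%:E * _ + _)%E; ring.
Qed.

End functionals_on_segments.

Theorem theorem3p9 (R : realType)
  (H : completeNormedModType R[i]) (dot : {dot H for Num.conj})
  (normE : forall u : H, `|u| ^+ 2 = dot u u)
  (C : set (H -> \bar R)) (Cfun : C `<=` functionals R H)
  (C0 : C !=set0) (Cconvex : convex_family C)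
  (Phi : (H -> \bar R) -> (H -> \bar R))
  (Phifun : set_fun C (functionals R H) Phi) :
  (pointwise_convex C Phi ->
    forall (a l : R) (f g : H -> \bar R),
    0 < a < 1 -> 0 < l < 1 -> C f -> C g -> forall x : H,
    ((m_coef a l)%:E * sube (nabla a (Phi f) (Phi g) x) (Phi (nabla a f g) x)
       <= sube (nabla l (Phi f) (Phi g) x)
               (\int[nu l]_(t in `[0%R, 1%R]) Phi (nabla t f g) x))%E
    /\
    (sube (nabla l (Phi f) (Phi g) x)
          (\int[nu l]_(t in `[0%R, 1%R]) Phi (nabla t f g) x)
       <= (M_coef a l)%:E
          * sube (nabla a (Phi f) (Phi g) x) (Phi (nabla a f g) x))%E)
  /\
  (pointwise_concave C Phi ->
    forall (a l : R) (f g : H -> \bar R),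
    0 < a < 1 -> 0 < l < 1 -> C f -> C g -> forall x : H,
    (sube (nabla l (Phi f) (Phi g) x)
          (\int[nu l]_(t in `[0%R, 1%R]) Phi (nabla t f g) x)
       <= (m_coef a l)%:E
          * sube (nabla a (Phi f) (Phi g) x) (Phi (nabla a f g) x))%E
    /\
    ((M_coef a l)%:E * sube (nabla a (Phi f) (Phi g) x) (Phi (nabla a f g) x)
       <= sube (nabla l (Phi f) (Phi g) x)
               (\int[nu l]_(t in `[0%R, 1%R]) Phi (nabla t f g) x))%E).
Proof.
have phiNy f g x : C f -> C g -> forall t, 0 <= t <= 1 ->
    Phi (nabla t f g) x != -oo%E.
  by move=> Cf Cg t t01; apply: Phifun; exact: Cconvex.
split=> cPhi a l f g a01 l01 Cf Cg x.
- have := econvex01_bounds l01 a (fun t => Phi (nabla t f g) x) a01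
    (phiNy _ _ x Cf Cg).
  rewrite nabla0 nabla1; apply => s t w s01 t01 w01 /=.
  rewrite -nabla_nabla//; [|exact: Cfun|exact: Cfun].
  by apply: cPhi => //; exact: Cconvex.
- have := econcave01_bounds l01 a (fun t => Phi (nabla t f g) x) a01
    (phiNy _ _ x Cf Cg).
  rewrite nabla0 nabla1; apply => s t w s01 t01 w01 /=.
  rewrite -nabla_nabla//; [|exact: Cfun|exact: Cfun].
  by apply: cPhi => //; exact: Cconvex.
Qed.
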